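(* Let $M$ be a matroid of rank $n$, where $n \ge 2$, let $B_1, \dots, B_n$ be pairwise disjoint bases of $M$, and let $\alpha = 3\lceil \log n \rceil$. Suppose $\alpha$-element subsets $S_1 \subseteq B_1, \dots, S_n \subseteq B_n$ are chosen independently, each $S_i$ uniformly at random among the $\alpha$-element subsets of $B_i$. Then, with probability at least $\tfrac12$, the collection $(S_1, \dots, S_n)$ contains a transversal basis, i.e. there is a basis of $M$ containing exactly one element from each of $S_1,\dots,S_n$.
   Context: Here $\log$ denotes the natural logarithm. *)

(* Defs.v *)
From HB Require Import structures.
From mathcomp Require Import all_boot all_order all_algebra.
From mathcomp Require Import reals exp Rstruct.
Set Implicit Arguments. Unset Strict Implicit. Unset Printing Implicit Defensive.
Import Order.TTheory GRing.Theory Num.Theory.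

Record matroid (T : finType) := Matroid {
  indep : {set T} -> bool;
  indep0 : indep set0;
  indep_sub : forall A B : {set T}, A \subset B -> indep B -> indep A;
  indep_exch : forall A B : {set T}, indep A -> indep B -> #|A| < #|B| ->
     exists2 x, x \in B :\: A & indep (x |: A)
}.

Definition is_basis (T : finType) (M : matroid T) (X : {set T}) : bool :=
  indep M X && [forall x, (x \notin X) ==> ~~ indep M (x |: X)].

Definition mrank (T : finType) (M : matroid T) : nat :=
  \max_(A : {set T} | indep M A) #|A|.

Definition alpha (n : nat) : nat :=
  (3 * `|Num.ceil (@ln Rdefinitions.R (n%:R)%R)|)%N.

Definition has_transversal_basis (T : finType) (M : matroid T) (n : nat)
    (S : {ffun 'I_n -> {set T}}) : bool :=
  [exists X : {set T}, is_basis M X && [forall i, #|X :&: S i| == 1%N]].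

(* sample space: tuples with S_i an alpha-subset of B_i (uniform product measure
   = uniform measure on this finite set) *)
Definition sample_space (T : finType) (n : nat) (B : 'I_n -> {set T}) :
    {set {ffun 'I_n -> {set T}}} :=
  [set S : {ffun 'I_n -> {set T}} | [forall i, (S i \subset B i) && (#|S i| == alpha n)]].

(* Main.v *)
Require Import Defs.
From mathcomp Require Import all_boot all_order all_algebra.
From mathcomp Require Import reals Rstruct sequences exp zify ring lra.
Set Implicit Arguments. Unset Strict Implicit. Unset Printing Implicit Defensive.
Import Order.TTheory GRing.Theory Num.Theory.

(** By Rado's theorem, a failing choice [S] has a set [J] of [k] indices such that
    [U_J], the union of the [S i] for [i] in [J], has rank less than [k].  Fix [J], put
    [m = n + 1 - k], and reveal the [S i], [i] in [J], one at a time.  If the revealed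
    union [F] has corank [d], the next basis contains [d] elements independent over
    [F], so the new corank is at most the number of them missed by [S i].  Counting
    missed [m]-subsets, the expectation of ['C(corank, m)] drops at each step by a
    factor at least ['C(n - m, alpha) / 'C(n, alpha)], whence
    [Pr (rk U_J < k) <= 'C(n, m) ('C(k - 1, alpha) / 'C(n, alpha)) ^ k].
    Multiplied by the number ['C(n, k)] of sets [J] this is at most [1 / (2 n)] for
    each of the [n] values of [k], and the union bound gives failure probability at
    most [1 / 2]. *)

Lemma card_bigcup_le (I T : finType) (P : pred I) (F : I -> {set T}) :
  #|\bigcup_(i | P i) F i| <= \sum_(i | P i) #|F i|.
Proof.
elim/big_rec2: _ => [|i k Y _ le]; first by rewrite cards0.
by rewrite cardsU; apply: leq_trans (leq_subr _ _) _; rewrite leq_add2l.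
Qed.

(** * Rank of a matroid *)

Section Rank.
Variables (T : finType) (M : matroid T).
Implicit Types A B X Y : {set T}.

Definition rk A : nat := \max_(X : {set T} | (X \subset A) && indep M X) #|X|.

Lemma indep_le_rk X A : X \subset A -> indep M X -> #|X| <= rk A.
Proof. by move=> sXA iX; apply: (bigop.bigmax_sup X); rewrite ?sXA. Qed.

Lemma indep_le_mrank X : indep M X -> #|X| <= mrank M.
Proof. by move=> iX; apply: (bigop.bigmax_sup X). Qed.

Lemma rk_le_mrank A : rk A <= mrank M.
Proof.
by apply/bigop.bigmax_leqP => X /andP[_ iX]; apply: indep_le_mrank.
Qed.

Lemma rk_le_card A : rk A <= #|A|.
Proof. by apply/bigop.bigmax_leqP => X /andP[sXA _]; apply: subset_leq_card. Qed.

Lemma rkS A B : A \subset B -> rk A <= rk B.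
Proof.
move=> sAB; apply/bigop.bigmax_leqP => X /andP[sXA iX].
exact: indep_le_rk (subset_trans sXA sAB) iX.
Qed.

Lemma rk_witness A : exists X, [/\ X \subset A, indep M X & #|X| = rk A].
Proof.
have [|X /andP[sXA iX] eX] :=
  @bigop.eq_bigmax_cond _ [pred X : {set T} | (X \subset A) && indep M X]
    (fun X : {set T} => #|X|).
  by apply/card_gt0P; exists set0; rewrite inE /= sub0set indep0.
by exists X; split=> //; rewrite /rk -eX.
Qed.

Lemma indep_extend X A : X \subset A -> indep M X ->
  exists Y, [/\ X \subset Y, Y \subset A, indep M Y & #|Y| = rk A].
Proof.
move=> sXA iX.
elim: {X}_.+1 {-2}X (ltnSn (rk A - #|X|)) sXA iX => // d IH X ltd sXA iX.
have leX := indep_le_rk sXA iX.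
have [eX|ltX] := eqVneq #|X| (rk A); first by exists X.
have [Z [sZA iZ eZ]] := rk_witness A.
have [|x] := indep_exch iX iZ; first by rewrite eZ ltn_neqAle ltX.
rewrite inE => /andP[xX xZ] ixX.
have cxX : #|x |: X| = #|X|.+1 by rewrite cardsU1 xX.
have [||//|Y [sxY sYA iY eY]] := IH (x |: X).
- by rewrite cxX; move: ltX ltd leX; lia.
- by rewrite subUset sub1set (subsetP sZA).
by exists Y; split=> //; apply: subset_trans sxY; apply: subsetUr.
Qed.

(** Extend a basis [X] of [A :&: B] to a basis [Y] of [A :|: B]; the parts of [Y] in [A] and in [B]
    are independent and share at least [X]. *)
Lemma rk_submod A B : rk (A :|: B) + rk (A :&: B) <= rk A + rk B.
Proof.
have [X [sX iX eX]] := rk_witness (A :&: B).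
have [|Y [sXY sY iY eY]] := @indep_extend X (A :|: B) _ iX.
  by apply: subset_trans sX _; apply: subset_trans (subsetIl _ _) (subsetUl _ _).
have le1 : #|Y :&: A| <= rk A.
  by rewrite indep_le_rk ?subsetIr // (indep_sub _ iY) ?subsetIl.
have le2 : #|Y :&: B| <= rk B.
  by rewrite indep_le_rk ?subsetIr // (indep_sub _ iY) ?subsetIl.
apply: leq_trans (leq_add le1 le2).
rewrite -cardsUI -setIUr (setIidPl sY) eY leq_add2l -eX subset_leq_card //.
by rewrite setIACA setIid subsetI sXY.
Qed.

Lemma is_basisE X : is_basis M X = indep M X && (#|X| == mrank M).
Proof.
have [iX /=|] := boolP (indep M X); last by rewrite /is_basis => /negbTE ->.
have leX := indep_le_mrank iX.
rewrite /is_basis iX /=; apply/forallP/eqP => [maxX|eX x]; last first.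
  apply/implyP => xX; apply/negP => ixX.
  by have := indep_le_mrank ixX; rewrite cardsU1 xX -eX ltnn.
apply/eqP; rewrite eqn_leq leX leqNgt; apply/negP => ltX.
have [Y [_ iY eY]] := rk_witness setT.
have eT : rk setT = mrank M by apply: eq_bigl => Z; rewrite subsetT.
have [|x] := indep_exch iX iY; first by rewrite eY eT.
by rewrite inE => /andP[xX _] ixX; have := maxX x; rewrite xX ixX.
Qed.

(* Contracting [F] leaves [mrank M - rk F] elements of any basis independent. *)
Lemma basis_complement F B : is_basis M B ->
  exists D : {set T}, [/\ D \subset B, #|D| = mrank M - rk F &
    forall S : {set T}, mrank M - rk (F :|: S) <= #|D :\: S|].
Proof.
rewrite is_basisE => /andP[iB /eqP cB].
have [X [sXF iX eX]] := rk_witness F.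
have [Y [sXY sY iY eY]] := indep_extend (subsetUl X B) iX.
have cY : #|Y| = mrank M.
  apply/eqP; rewrite eqn_leq {1}eY rk_le_mrank /= eY -cB.
  exact: indep_le_rk (subsetUr X B) iB.
have cD : #|Y :\: X| = mrank M - rk F by rewrite cardsD (setIidPr sXY) cY eX.
exists (Y :\: X); split=> // [|S].
  apply/subsetP => x; rewrite inE => /andP[xX /(subsetP sY)].
  by rewrite inE (negbTE xX).
(* [D :&: S] can be added to the basis [X] of [F], so the rank grows by at least the number of
   elements of [D] that [S] hits. *)
have le1 : #|X :|: ((Y :\: X) :&: S)| <= rk (F :|: S).
  apply: indep_le_rk; first by rewrite setUSS // subsetIr.
  apply: indep_sub iY; rewrite subUset sXY /=.
  by apply: subset_trans (subsetIl _ _) (subsetDl _ _).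
have dj : X :&: ((Y :\: X) :&: S) = set0.
  by apply/setP => x; rewrite !inE; case: (x \in X).
have := cardsUI X ((Y :\: X) :&: S); rewrite dj cards0 addn0 => e.
have := cardsID S (Y :\: X); rewrite e in le1.
by rewrite cD; move: le1; rewrite eX; lia.
Qed.

End Rank.

(** * Rado's theorem *)

Section Rado.
Variables (T : finType) (M : matroid T) (n : nat).
Implicit Types (A S : {ffun 'I_n -> {set T}}) (J : {set 'I_n}).

Definition rado A := [forall J : {set 'I_n}, #|J| <= rk M (\bigcup_(i in J) A i)].

Definition shrink A (i : 'I_n) (x : T) : {ffun 'I_n -> {set T}} :=
  [ffun j => if j == i then A i :\ x else A j].

(** A violator of the shrunken family contains [i], since otherwise it would already violate [A];
    removing [i] from it gives [J]. *)
Lemma rado_shrinkPn A i x : rado A -> ~~ rado (shrink A i x) ->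
  exists2 J : {set 'I_n}, i \notin J &
    rk M ((A i :\ x) :|: \bigcup_(j in J) A j) <= #|J|.
Proof.
move=> /forallP rA; rewrite negb_forall => /existsP[J]; rewrite -ltnNge => ltJ.
have out (K : {set 'I_n}) : i \notin K ->
    \bigcup_(j in K) shrink A i x j = \bigcup_(j in K) A j.
  move=> iK; apply: eq_bigr => j jK; rewrite ffunE.
  by case: eqP => // ji; rewrite ji (negbTE iK) in jK.
have [iJ|iJ] := boolP (i \in J); last first.
  by move: ltJ; rewrite out // ltnNge rA.
exists (J :\ i); first by rewrite !inE eqxx.
move: ltJ; rewrite (cardsD1 i) iJ (big_setD1 i) //= out ?inE ?eqxx //.
by rewrite ffunE eqxx.
Qed.

(** If both deletions failed, submodularity applied to the two violators would contradict [rado A]: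
    as [x != y], the union regains all of [A i] and has rank at least [#|J :|: K| + 1]. *)
Lemma rado_shrink A i x y : rado A -> x \in A i -> y \in A i -> x != y ->
  rado (shrink A i x) || rado (shrink A i y).
Proof.
move=> rA xA yA xy; apply/norP => -[].
move=> /(rado_shrinkPn rA)[J iJ leJ] /(rado_shrinkPn rA)[K iK leK].
have := rk_submod M ((A i :\ x) :|: \bigcup_(j in J) A j)
                    ((A i :\ y) :|: \bigcup_(j in K) A j).
move/forallP: rA => rA.
have geU : #|i |: (J :|: K)| <= rk M (((A i :\ x) :|: \bigcup_(j in J) A j)
                    :|: ((A i :\ y) :|: \bigcup_(j in K) A j)).
  apply: leq_trans (rA _) (rkS _ _); rewrite bigcup_setU big_set1 bigcup_setU.
  rewrite setUACA; apply: setUSS => //; apply/subsetP => z zA.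
  by rewrite !inE zA !andbT; have [->|//] := eqVneq z x; rewrite xy.
have geI : #|J :&: K| <= rk M (((A i :\ x) :|: \bigcup_(j in J) A j)
                    :&: ((A i :\ y) :|: \bigcup_(j in K) A j)).
  apply: leq_trans (rA _) (rkS _ _); apply/bigcupsP => j.
  rewrite inE => /andP[jJ jK]; rewrite subsetI !subsetU //.
    by rewrite (bigcup_sup j) ?orbT.
  by rewrite (bigcup_sup j) ?orbT.
rewrite cardsU1 inE negb_or iJ iK in geU.
move=> sub; have := leq_trans (leq_add geU geI) (leq_trans sub (leq_add leJ leK)).
by rewrite -cardsUI !addSn ltnn.
Qed.

(** Delete elements one at a time while some set has two; the condition on one-element index sets
    keeps every set nonempty. *)
Lemma rado_singletons A : rado A ->
  exists A', [/\ rado A', forall i, A' i \subset A i & forall i, #|A' i| = 1].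
Proof.
elim: {A}_.+1 {-2}A (ltnSn (\sum_i #|A i|)) => // d IH A ltd rA.
have [/existsP[i]|] := boolP [exists i, 1 < #|A i|]; last first.
  rewrite negb_exists => /forallP le1; exists A; split=> // i.
  apply/eqP; rewrite eqn_leq leqNgt le1 /=.
  have := forallP rA [set i]; rewrite cards1 big_set1 => h.
  exact: leq_trans h (rk_le_card _ _).
case/card_gt1P=> x [y [xA yA xy]].
wlog rx : x y xA yA xy / rado (shrink A i x).
  move=> W; have /orP[rx|ry] := rado_shrink rA xA yA xy; first exact: (W x y).
  by apply: (W y x) => //; rewrite eq_sym.
have [|A' [rA' sA' cA']] := IH (shrink A i x) _ rx.
  move: ltd; rewrite ltnS; apply: leq_trans.
  rewrite [X in _ < X](bigD1 i) //= (bigD1 i) //= ffunE eqxx.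
  rewrite [#|A i|](cardsD1 x) xA add1n addSn ltnS leq_add2l.
  by apply: leq_sum => j /negbTE ji; rewrite ffunE ji.
exists A'; split=> // j; apply: subset_trans (sA' j) _; rewrite ffunE.
by case: eqP => [->|//]; apply: subsetDl.
Qed.

(** The condition on all indices gives the union of the [n] singletons rank [n], so it is a basis;
    disjointness makes it meet each [S i] only in its own singleton. *)
Lemma rado_transversal S : mrank M = n ->
  (forall i j, i != j -> [disjoint S i & S j]) ->
  rado S -> has_transversal_basis M S.
Proof.
move=> rM dS /rado_singletons[A [rA sA cA]].
pose X := \bigcup_i A i.
have cX : #|X| <= n.
  have -> : n = \sum_(i < n) #|A i|.
    by under eq_bigr do rewrite cA; rewrite sum1_card card_ord.
  exact: card_bigcup_le.
have rX : n <= rk M X.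
  by have := forallP rA setT; rewrite cardsT card_ord; under eq_bigl do rewrite inE.
have [Y [sYX iY eY]] := rk_witness M X.
have eYX : Y = X by apply/eqP; rewrite eqEcard sYX eY (leq_trans cX rX).
apply/existsP; exists X; rewrite is_basisE rM -eYX iY /= eqn_leq {1}eYX cX.
rewrite eY rX /=; apply/forallP => i; rewrite eYX -(cA i).
apply/eqP; congr #|pred_of_set _|.
apply/setP => x; rewrite inE; apply/andP/idP => [[/bigcupP[j _ xj] xi]|xi].
  have [<-//|ji] := eqVneq j i.
  by have := disjointFr (dS _ _ ji) (subsetP (sA j) x xj); rewrite xi.
by split; [apply/bigcupP; exists i | apply: (subsetP (sA i))].
Qed.

End Rado.

(** * Numerical estimates *)

(** After clearing [a!], compare falling factorials factor by factor:
    [(j - i) / (n - i) <= j / n]. *)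
Lemma bin_ratio_le_exp (j n a : nat) : j <= n ->
  'C(j, a) * n ^ a <= 'C(n, a) * j ^ a.
Proof.
move=> jn; rewrite -(leq_pmul2r (fact_gt0 a)) mulnAC bin_ffact.
rewrite [in leqRHS]mulnAC bin_ffact.
elim: a => [//|a IH]; rewrite !ffactnSr !expnSr mulnACA [leqRHS]mulnACA.
apply: leq_mul => //; rewrite mulnBl mulnBl [n * j]mulnC.
by rewrite leq_sub2l // leq_mul2l jn orbT.
Qed.

Lemma bin_le_exp (n m : nat) : 'C(n, m) * m`! <= n ^ m.
Proof.
rewrite bin_ffact; elim: m => [//|m IH]; rewrite ffactnSr expnSr.
by apply: leq_mul => //; apply: leq_subr.
Qed.

Lemma bin_le_exp2 (n m : nat) : 'C(n, m) <= 2 ^ n.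
Proof.
have [lemn|ltnm] := leqP m n; last by rewrite bin_small.
have := expnDn 1 1 n; rewrite addn1 => ->.
rewrite (bigD1 (inord m : 'I_n.+1)) //= inordK ?ltnS // !exp1n !muln1.
exact: leq_addr.
Qed.

(** * Binomial products against exponentials *)

Section ExponentialBounds.
Local Open Scope ring_scope.
Variable R : realType.

Lemma expR1_lt3 : expR (1 : R) < 3.
Proof.
(* [e <= (6/5)^6 < 3], because [1 - 1/6 <= exp (- 1/6)]. *)
have h : expR (6^-1 : R) <= 6 / 5.
  rewrite -[6^-1]opprK expRN -[6 / 5]invrK lef_pV2 ?posrE ?expR_gt0 //; last by lra.
  by apply: le_trans (expR_ge1Dx _); lra.
have -> : 1 = 6%:R * 6^-1 :> R by field.
rewrite expRM_natl; apply: (@le_lt_trans _ _ ((6 / 5) ^+ 6)); last by lra.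
by rewrite lerXn2r // nnegrE ?expR_ge0 //; lra.
Qed.

Variables (n L : nat).
Hypothesis leL : n%:R <= expR (L%:R : R).

Lemma exp_nat_le_expR p : (n ^ p)%:R <= expR (L%:R * p%:R : R).
Proof. by rewrite natrX expRM_natr lerXn2r // nnegrE ?expR_ge0. Qed.

(* With [m + k = n + 1], [((k - 1) / n) ^ (3 L k) = (1 - m / n) ^ (3 L k)] is at most
   the inverse of this weight, which is symmetric in [m] and [k]. *)
Definition tail_weight m k : R :=
  expR (L%:R * (3 * m%:R * k%:R / n%:R)).

Lemma expR_le_tail_weight x m k : (0 < n)%N -> x * n%:R <= 3 * m%:R * k%:R ->
  expR (L%:R * x) <= tail_weight m k.
Proof.
move=> n0 h; rewrite ler_expR ler_wpM2l // ler_pdivlMr //.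
by rewrite ltr0n.
Qed.

Lemma tail_bound1 : (2 <= n)%N ->
  (('C(n, 1) * 'C(n, n)) * (2 * n))%:R <= tail_weight 1 n.
Proof.
move=> n2; apply: (@le_trans _ _ (expR (L%:R * 3%:R))); last first.
  by apply: expR_le_tail_weight; [lia | rewrite mulr1].
apply: le_trans (exp_nat_le_expR 3); rewrite ler_nat bin1 binn muln1.
by rewrite !expnS expn0; nia.
Qed.

(** Here [3 k / n >= 2], so the weight is at least [n ^ (2 m)], while
    ['C(n, k) = 'C(n, m - 1) <= n ^ (m - 1)] and, for [m >= 2], ['C(n, m) <= n ^ m / 2]. *)
Lemma tail_bound_left m k : (2 <= n)%N -> (0 < m)%N -> (m + k = n.+1)%N ->
  (2 * n <= 3 * k)%N -> (('C(n, m) * 'C(n, k)) * (2 * n))%:R <= tail_weight m k.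
Proof.
move=> n2 m0 mk hk; have [m1|m1] := eqVneq m 1%N.
  have -> : k = n by lia.
  by rewrite m1; apply: tail_bound1.
apply: (@le_trans _ _ (expR (L%:R * (2 * m)%:R))); last first.
  apply: expR_le_tail_weight; first by lia.
  by rewrite -!natrM ler_nat; nia.
apply: le_trans (exp_nat_le_expR _); rewrite ler_nat.
have -> : 'C(n, k) = 'C(n, m.-1).
  by rewrite -bin_sub; [congr 'C(_, _); lia | lia].
have h1 : ('C(n, m) * 2 <= n ^ m)%N.
  apply: leq_trans (bin_le_exp n m); rewrite leq_mul2l.
  by rewrite (@leq_fact 2) ?orbT //; lia.
have h2 : ('C(n, m.-1) <= n ^ m.-1)%N.
  by apply: leq_trans (bin_le_exp n m.-1); rewrite leq_pmulr // fact_gt0.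
have -> : (2 * m = m + m.-1.+1)%N by lia.
rewrite expnD expnS.
have -> : ('C(n, m) * 'C(n, m.-1) * (2 * n) = ('C(n, m) * 2) * (n * 'C(n, m.-1)))%N.
  by ring.
by apply: leq_mul => //; rewrite leq_mul2l h2 orbT.
Qed.

Lemma tail_bound_middle m k : (8 <= n)%N -> (m + k = n.+1)%N ->
  (3 * k <= 2 * n)%N -> (3 * m <= 2 * n)%N ->
  (('C(n, m) * 'C(n, k)) * (2 * n))%:R <= tail_weight m k.
Proof.
move=> n8 mk hk hm.
(* For [m + k = n + 1] with both at most [2 n / 3], [m k] is smallest at an endpoint, where
   [3 m k / n = 2 + 2 n / 3]. *)
apply: (@le_trans _ _ (expR (L%:R * (2 + 2 / 3 * n%:R)))); last first.
  apply: expR_le_tail_weight; first by lia.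
  have h : (6 * n + 2 * n * n <= 9 * m * k)%N by nia.
  by move: h; rewrite -(ler_nat R) !natrD !natrM; lra.
rewrite mulrDr expRD mulrA [X in _ * X]expRM_natr.
(* The cube of this exponential is at least [n ^ 2 >= 64], by [n >= 8]; its [n]-th power [4 ^ n]
   will absorb both binomials. *)
have h4 : 4 <= expR (L%:R * (2 / 3) : R).
  rewrite -(@ler_pXn2r _ 3) ?nnegrE ?expR_ge0 //.
  rewrite -expRM_natr -mulrA.
  have -> : 2 / 3 * 3%:R = 2%:R :> R by field.
  apply: le_trans (exp_nat_le_expR 2); rewrite -natrX ler_nat.
  by rewrite -[(4 ^ 3)%N]/(8 ^ 2)%N leq_exp2r.
have h2 := exp_nat_le_expR 2.
apply: (@le_trans _ _ ((n ^ 2)%:R * 4 ^+ n)); last first.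
  by rewrite ler_pM // ?exprn_ge0 ?lerXn2r ?nnegrE ?expR_ge0.
rewrite -natrX -natrM ler_nat mulnC; apply: leq_mul; first by nia.
have -> : (4 ^ n = 2 ^ n * 2 ^ n)%N by rewrite -expnMn.
by apply: leq_mul; apply: bin_le_exp2.
Qed.

Lemma tail_bound m k : (8 <= n)%N -> (0 < m)%N -> (0 < k)%N -> (m + k = n.+1)%N ->
  (('C(n, m) * 'C(n, k)) * (2 * n))%:R <= tail_weight m k.
Proof.
move=> n8 m0 k0 mk; have [hk|hk] := leqP (2 * n) (3 * k).
  by apply: tail_bound_left => //; lia.
have [hm|hm] := leqP (2 * n) (3 * m).
  have -> : tail_weight m k = tail_weight k m by rewrite /tail_weight (mulrAC 3).
  by rewrite [('C(n, m) * _)%N]mulnC; apply: tail_bound_left => //; lia.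
by apply: tail_bound_middle => //; lia.
Qed.

(** The weight is [expR (m / n)] to the power [3 L k], and [(k - 1) / n = 1 - m / n <= expR (- m /
    n)]. *)
Lemma expn_mul_tail_weight_le m k : (0 < n)%N -> (m + k = n.+1)%N -> (0 < k)%N ->
  (k.-1 ^ (3 * L * k))%:R * tail_weight m k <= (n ^ (3 * L * k))%:R.
Proof.
move=> n0 mk k0.
have nR : 0 < n%:R :> R by rewrite ltr0n.
have -> : tail_weight m k = expR (m%:R / n%:R) ^+ (3 * L * k).
  rewrite -expRM_natr /tail_weight !natrM; congr expR; field.
  by rewrite gt_eqF.
rewrite !natrX -exprMn lerXn2r ?nnegrE ?mulr_ge0 ?expR_ge0 //.
rewrite -ler_pdivlMr ?expR_gt0 // -expRN.
rewrite mulrC -ler_pdivrMr //; apply: le_trans (expR_ge1Dx _).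
rewrite ler_pdivrMr // mulrDl mul1r mulNr divfK ?gt_eqF // lerBrDr -natrD ler_nat.
by lia.
Qed.

Lemma bad_count_bound m k : (2 <= n)%N -> (0 < m)%N -> (0 < k)%N ->
  (m + k = n.+1)%N ->
  (('C(n, m) * 'C(n, k)) * (2 * n) * 'C(k.-1, 3 * L) ^ k <= 'C(n, 3 * L) ^ k)%N.
Proof.
move=> n2 m0 k0 mk.
have [small|large] := ltnP k.-1 (3 * L).
  by rewrite (bin_small small) exp0n ?muln0.
have hE : (('C(n, m) * 'C(n, k)) * (2 * n))%:R <= tail_weight m k.
  have [n8|n8] := leqP 8 n; first exact: tail_bound.
  (* For [n <= 7], [3 L >= n - 1] leaves only [k = n]. *)
  have L0 : (L != 0)%N.
    apply/eqP => L0; move: leL; rewrite L0 mulr0n expR0 -[1]/(1%:R) ler_nat; lia.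
  have L1 : (2 < n)%N -> L <> 1%N.
    move=> n3 L1; have := le_lt_trans leL; rewrite L1 => /(_ _ expR1_lt3).
    by rewrite ltr_nat; lia.
  have kn : k = n by lia.
  have m1 : m = 1%N by lia.
  by rewrite kn m1; apply: tail_bound1.
have h1 := bin_ratio_le_exp (3 * L) (ltac:(lia) : (k.-1 <= n)%N).
have h2 : ('C(k.-1, 3 * L) ^ k * n ^ (3 * L * k) <=
           'C(n, 3 * L) ^ k * k.-1 ^ (3 * L * k))%N.
  by rewrite !(expnM _ (3 * L) k) -!expnMn leq_exp2r.
have h3 := expn_mul_tail_weight_le (ltac:(lia) : (0 < n)%N) mk k0.
have p0 : (0 < n ^ (3 * L * k))%N by rewrite expn_gt0; lia.
rewrite -(leq_pmul2r p0) -mulnA.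
apply: leq_trans (leq_mul (leqnn _) h2) _.
rewrite mulnCA leq_mul2l -(ler_nat R) natrM; apply/orP; right.
apply: le_trans h3; rewrite mulrC; apply: ler_wpM2l => //.
Qed.

End ExponentialBounds.

(** * Counting families that violate Rado's condition *)

Section Count.
Variables (T : finType) (M : matroid T) (n : nat) (B : 'I_n -> {set T}).
Hypothesis rM : mrank M = n.
Hypothesis bB : forall i, is_basis M (B i).
Implicit Types (S : {ffun 'I_n -> {set T}}) (J : {set 'I_n}).

Definition alpha_subsets i : {set {set T}} :=
  [set U : {set T} | U \subset B i & #|U| == alpha n].

Lemma sample_spaceE S :
  (S \in sample_space B) = [forall i, S i \in alpha_subsets i].
Proof. by rewrite inE; apply: eq_forallb => i; rewrite inE. Qed.

Lemma card_B i : #|B i| = n.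
Proof. by have := bB i; rewrite is_basisE rM => /andP[_ /eqP]. Qed.

Lemma card_alpha_subsets i : #|alpha_subsets i| = 'C(n, alpha n).
Proof. by rewrite cards_draws card_B. Qed.

Definition upd S (i : 'I_n) (U : {set T}) : {ffun 'I_n -> {set T}} :=
  [ffun j => if j == i then U else S j].

(** Redrawing coordinate [i] preserves the uniform measure: exchanging [S i] with the fresh set [U]
    is an involution on pairs. *)
Lemma resample (g : {ffun 'I_n -> {set T}} -> nat) i :
  'C(n, alpha n) * \sum_(S in sample_space B) g S =
  \sum_(S in sample_space B) \sum_(U in alpha_subsets i) g (upd S i U).
Proof.
rewrite pair_big /=.
pose swap (p : {ffun 'I_n -> {set T}} * {set T}) := (upd p.1 i p.2, p.1 i).
have swapK : involutive swap.
  move=> [S U]; rewrite /swap /= ffunE eqxx; congr pair.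
  by apply/ffunP => j; rewrite !ffunE; case: eqP => // ->.
rewrite (reindex_inj (inv_inj swapK)) /=.
rewrite -(card_alpha_subsets i) mulnC big_distrl /=.
under eq_bigr do rewrite mulnC -sum_nat_const.
rewrite pair_big /=; apply: eq_big => [[S U]|[S U] _] /=; last first.
  congr g; apply/ffunP => j; rewrite !ffunE.
  by case: eqP => // ->.
rewrite !sample_spaceE; apply/andP/andP => -[/forallP hS hU]; split=> //.
- by apply/forallP => j; rewrite ffunE; case: eqP => // ->.
- by apply/forallP => j; have [->|ji] := eqVneq j i; last by
    have := hS j; rewrite ffunE (negbTE ji).
- by have := hS i; rewrite ffunE eqxx.
Qed.

(* ['C(#|D :\: U|, m)] counts the [m]-subsets of [D] that miss [U]; exchange the sums. *)
Lemma sum_bin_deficit (F : {set T}) i m :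
  \sum_(U in alpha_subsets i) 'C(n - rk M (F :|: U), m) <=
  'C(n - m, alpha n) * 'C(n - rk M F, m).
Proof.
have [D [sDB cD leD]] := basis_complement F (bB i).
rewrite rM in cD leD.
apply: (@leq_trans (\sum_(U in alpha_subsets i)
   \sum_(A : {set T} | (A \subset D) && (#|A| == m)) [disjoint A & U])).
  apply: leq_sum => U _; apply: leq_trans (leq_bin2l m (leD U)) _.
  rewrite -cards_draws -sum1_card -big_mkcondr /= leq_eqVlt; apply/orP; left.
  apply/eqP/eq_bigl => A; rewrite inE subsetD -!andbA; congr (_ && _).
  exact: andbC.
rewrite exchange_big /= -cD -cards_draws -sum1_card big_distrr /=.
under [leqRHS]eq_bigl do rewrite inE.
apply: leq_sum => A /andP[sAD /eqP cA]; rewrite muln1.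
rewrite -big_mkcondr sum1_card.
have -> : n - m = #|B i :\: A|.
  by rewrite cardsD (setIidPr (subset_trans sAD sDB)) card_B cA.
rewrite -cards_draws subset_leq_card //; apply/subsetP => U.
by rewrite unfold_in /= !inE subsetD disjoint_sym => /andP[/andP[-> ->] ->].
Qed.

(** Divided by the size of the sample space, this is the expectation of ['C(corank, m)] for the
    union revealed on [J]. *)
Definition deficit_sum m J :=
  \sum_(S in sample_space B) 'C(n - rk M (\bigcup_(j in J) S j), m).

(** Redraw [S i]: the union over [J :\ i] ignores coordinate [i] and can serve as [F] in
    [sum_bin_deficit]. *)
Lemma deficit_sum_step m J i : i \in J ->
  'C(n, alpha n) * deficit_sum m J <= 'C(n - m, alpha n) * deficit_sum m (J :\ i).
Proof.
move=> iJ; rewrite (resample _ i) big_distrr /=; apply: leq_sum => S _.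
apply: leq_trans (sum_bin_deficit _ i m); apply: leq_sum => U _.
rewrite (big_setD1 i) //= ffunE eqxx setUC.
rewrite (_ : \bigcup_(j in J :\ i) upd S i U j = \bigcup_(j in J :\ i) S j) //.
by apply: eq_bigr => j; rewrite !inE ffunE => /andP[/negbTE ->].
Qed.

Lemma deficit_sum_bound m J :
  'C(n, alpha n) ^ #|J| * deficit_sum m J <=
  'C(n - m, alpha n) ^ #|J| * ('C(n, m) * #|sample_space B|).
Proof.
have [k eJ] : exists k, #|J| = k by exists #|J|.
elim: k J eJ => [|k IH] J eJ; rewrite eJ.
  rewrite !expn0 !mul1n mulnC -sum_nat_const; apply: leq_sum => S _.
  exact/leq_bin2l/leq_subr.
have /card_gt0P[i iJ] : 0 < #|J| by rewrite eJ.
have eJi : #|J :\ i| = k by move: eJ; rewrite (cardsD1 i) iJ => -[].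
rewrite !expnSr -mulnA; apply: leq_trans (leq_mul (leqnn _) (deficit_sum_step m iJ)) _.
have := IH _ eJi; rewrite eJi => IHk.
by rewrite mulnCA (mulnC (_ ^ k) 'C(n - m, alpha n)) -mulnA leq_mul2l IHk orbT.
Qed.

Definition rado_violators J : {set {ffun 'I_n -> {set T}}} :=
  [set S in sample_space B | rk M (\bigcup_(j in J) S j) < #|J|].

(** Markov's inequality: a violator has corank at least [n + 1 - #|J|], hence contributes at least
    1. *)
Lemma card_rado_violators_le_deficit J :
  #|rado_violators J| <= deficit_sum (n.+1 - #|J|) J.
Proof.
rewrite -sum1_card /deficit_sum big_mkcond [leqRHS]big_mkcond /=.
apply: leq_sum => S _; rewrite inE; case: ifP => //= /andP[-> lt].
by rewrite bin_gt0 -[n - _]subSS leq_sub2l.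
Qed.

End Count.

(** * Union bound over the index sets *)

Section FailureProbability.
Variables (T : finType) (M : matroid T) (n : nat) (B : 'I_n -> {set T}).
Hypothesis n2 : 2 <= n.
Hypothesis rM : mrank M = n.
Hypothesis bB : forall i, is_basis M (B i).

(** [L] is the ceiling of [ln n]; the absolute value in [alpha] is harmless because [ln n >= 0]. *)
Lemma leq_expR_alpha : exists2 L : nat, alpha n = 3 * L &
  (n%:R <= expR (L%:R : Rdefinitions.R))%R.
Proof.
exists `|Num.ceil (@ln Rdefinitions.R (n%:R)%R)|%N => //.
set x : Rdefinitions.R := ln _.
have nR : ((n%:R : Rdefinitions.R) \is Num.pos)%R by rewrite posrE ltr0n; lia.
have x0 : (0 <= x)%R by rewrite ln_ge0 // ler1n; lia.
rewrite -{1}(lnK nR) ler_expR natr_absz ger0_norm ?ceil_ge //.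
by rewrite ceil_ge0 (lt_le_trans _ x0) // ltrN10.
Qed.

Lemma card_rado_violators (J : {set 'I_n}) : J != set0 ->
  2 * n * 'C(n, #|J|) * #|rado_violators M B J| <= #|sample_space B|.
Proof.
rewrite -card_gt0 => J0.
have leJ : #|J| <= n by rewrite -[leqRHS](card_ord n) max_card.
(* If [alpha n > n], the factor ['C(n, alpha n)] cannot be cancelled, but then the sample space is
   empty. *)
have [N0|N0] := posnP 'C(n, alpha n).
  suff -> : rado_violators M B J = set0 by rewrite cards0 muln0.
  apply/eqP; rewrite -subset0; apply/subsetP => S; rewrite inE => /andP[].
  rewrite sample_spaceE => /forallP/(_ (Ordinal (ltnW n2))) hS.
  by have := card_alpha_subsets rM bB (Ordinal (ltnW n2)); rewrite N0 =>
    /cards0_eq e; rewrite e inE in hS.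
have [L eL leL] := leq_expR_alpha.
have := deficit_sum_bound rM bB (n.+1 - #|J|) J.
have := card_rado_violators_le_deficit M B J.
set k := #|J|; set v := #|rado_violators M B J|; set w := #|sample_space B|.
set d := deficit_sum _ _ _ _ => le_vd bd.
have ek : n - (n.+1 - k) = k.-1 by rewrite /k; lia.
have num := @bad_count_bound _ n L leL (n.+1 - k) k n2.
rewrite -eL in num; rewrite ek in bd.
have {}num := num ltac:(lia) J0 ltac:(lia).
have p0 : 0 < 'C(n, alpha n) ^ k by rewrite expn_gt0 N0.
rewrite -(leq_pmul2l p0) mulnCA.
apply: leq_trans (leq_mul (leqnn _) (leq_mul (leqnn _) le_vd)) _.
apply: leq_trans (leq_mul (leqnn _) bd) _.
apply: leq_trans (leq_mul num (leqnn w)); rewrite leq_eqVlt; apply/orP; left.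
by apply/eqP; ring.
Qed.

(** Group the [J] by size: the ['C(n, k)] sets of size [k] together account for at most [1 / (2 n)]
    of the samples, and there are [n] sizes. *)
Lemma sum_rado_violators :
  2 * \sum_(J : {set 'I_n} | J != set0) #|rado_violators M B J| <= #|sample_space B|.
Proof.
have n0 : 0 < n by lia.
rewrite -(leq_pmul2l n0) mulnA [n * 2]mulnC.
have sz (J : {set 'I_n}) : J != set0 -> #|J|.-1 < n.
  rewrite -card_gt0 => J0.
  have : #|J| <= n by rewrite -[leqRHS](card_ord n) max_card.
  by lia.
(* Sizes from 1 to [n] are indexed by [#|J| - 1]; the type ['I_n.-1.+1] provides the successor bound
   required by [inord]. *)
rewrite (partition_big (fun J : {set 'I_n} => inord #|J|.-1 : 'I_n.-1.+1) xpredT) //=.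
rewrite -[X in X * #|_|](prednK n0) -[X in X * #|_|]card_ord -sum_nat_const.
rewrite big_distrr /=; apply: leq_sum => k _.
have eJ (J : {set 'I_n}) : (J != set0) && (inord #|J|.-1 == k) = (#|J| == k.+1).
  apply/andP/eqP => [[J0 /eqP <-]|eJ].
    by rewrite inordK ?(prednK n0) ?sz // prednK // card_gt0.
  by rewrite -card_gt0 eJ /= inord_val.
rewrite (eq_bigl _ _ eJ).
have kn : k < n by rewrite -[leqRHS](prednK n0) ltn_ord.
have p0 : 0 < 'C(n, k.+1) by rewrite bin_gt0.
have eC : 'C(n, k.+1) * #|sample_space B| =
    \sum_(J : {set 'I_n} | #|J| == k.+1) #|sample_space B|.
  have := card_draws 'I_n k.+1; rewrite card_ord => <-; rewrite -sum_nat_const.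
  by apply: eq_bigl => J; rewrite inE.
rewrite -(leq_pmul2l p0) eC mulnA big_distrr /=.
apply: leq_sum => J /eqP cJ.
rewrite ['C(_, _) * _]mulnC -cJ; apply: card_rado_violators.
by rewrite -card_gt0 cJ.
Qed.

End FailureProbability.

Theorem theorem1p3 (T : finType) (M : matroid T) (n : nat) (B : 'I_n -> {set T}) :
  (2 <= n)%N ->
  mrank M = n ->
  (forall i, is_basis M (B i)) ->
  (forall i j, i != j -> [disjoint B i & B j]) ->
  (* Pr[ transversal basis ] >= 1/2 under the uniform distribution *)
  (#|sample_space B| <= 2 * #|[set S in sample_space B | has_transversal_basis M S]|)%N.
Proof.
move=> n2 rM bB dB.
(* By Rado's theorem a failing tuple violates the condition at some [J], nonempty because the empty
   set never violates it. *)
have bad : #|[set S in sample_space B | ~~ has_transversal_basis M S]| <=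
    \sum_(J : {set 'I_n} | J != set0) #|rado_violators M B J|.
  apply: leq_trans (card_bigcup_le _ _).
  apply: subset_leq_card; apply/subsetP => S; rewrite inE => /andP[SB].
  apply: contraR => nS; apply: rado_transversal => // [i j ij|].
    move: SB; rewrite inE => /forallP sB.
    have /andP[si _] := sB i; have /andP[sj _] := sB j.
    exact: disjointWl si (disjointWr sj (dB _ _ ij)).
  apply/forallP => J; have [->|J0] := eqVneq J set0; first by rewrite cards0.
  rewrite leqNgt; apply: contra nS => ltJ.
  by apply/bigcupP; exists J; rewrite // inE SB.
have := sum_rado_violators n2 rM bB.
have : #|sample_space B| =
    #|[set S in sample_space B | has_transversal_basis M S]| +
    #|[set S in sample_space B | ~~ has_transversal_basis M S]|.
  rewrite -(cardsID [set S | has_transversal_basis M S] (sample_space B)).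
  by congr (_ + _); apply: eq_card => S; rewrite !inE // andbC.
move: bad; lia.
Qed.
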